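(* Let $K=\mathbb{F}_q$ be a finite field, let $S=K[t_1,\ldots,t_s]$, let $X$ be a subset of $\mathbb{A}^s=K^s$, let $I=I(X)$ be the vanishing ideal of $X$, and let $d\geq 1$ be an integer. If $\prec$ is a graded monomial order on $S$, then $$ \delta_r(C_X(d))=\deg(S/I)-\max\{\deg(S/(I,F))\mid F\in\mathcal{F}_{\prec,d,r}\}\quad\mbox{for } 1\leq r\leq H_I^a(d). $$
   Context: $I(X)$ is the set of all $f\in S$ vanishing at every point of $X$. A monomial order is graded if monomials are first compared by total degree. ${\rm in}_\prec(f)$ is the initial monomial of a nonzero $f$; $\Delta_\prec(I)$ is the set of standard monomials of $S/I$, i.e. monomials not in the initial ideal ${\rm in}_\prec(I)$; a standard polynomial of $S/I$ is a nonzero $K$-linear combination of standard monomials; monic means the leading coefficient with respect to $\prec$ is $1$. $S_{\leq d}$ is the space of polynomials of degree at most $d$. Write $X=\{P_1,\ldots,P_m\}$ (distinct points). The Reed–Muller-type code of degree $d$ on $X$ is $C_X(d)=\{(f(P_1),\ldots,f(P_m))\mid f\in S_{\leq d}\}\subset K^m$. $\mathcal{F}_{\prec,d,r}$ is the set of all $F=\{f_1,\ldots,f_r\}\subset S_{\leq d}$ such that each $f_i$ is a standard monic polynomial of $S/I$ and ${\rm in}_\prec(f_1),\ldots,{\rm in}_\prec(f_r)$ are distinct monomials. $(I,F)$ is the ideal generated by $I\cup F$. For an ideal $J\subset S$, the affine Hilbert function is $H_J^a(d)=\dim_K(S_{\leq d}/J_{\leq d})$, with $J_{\leq d}=J\cap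 S_{\leq d}$. If $J\subsetneq S$ and $k=\dim(S/J)$ (Krull dimension), then for $d\gg0$ $H_J^a(d)$ is a polynomial in $d$ of degree $k$ with leading coefficient $a_k$, and $\deg(S/J)=k!\,a_k$; $\deg(S/J)=0$ if $J=S$. In particular, if $k=0$, then $\deg(S/J)=\dim_K(S/J)$. For a linear code $C\subset K^m$ and $1\leq r\leq\dim_K C$, $\delta_r(C)=\min\{|\chi(D)| : D \text{ a linear subspace of } C,\ \dim_K D=r\}$, where $\chi(D)=\{i : \exists\,(a_1,\ldots,a_m)\in D,\ a_i\neq 0\}$. *)

(* Defs.v *)
From HB Require Import structures.
From mathcomp Require Import all_boot all_order all_algebra.
From mathcomp Require Export mpoly.
From Stdlib Require Import ClassicalEpsilon.

Set Implicit Arguments.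
Unset Strict Implicit.
Unset Printing Implicit Defensive.

Import Order.TTheory GRing.Theory Num.Theory.
Local Open Scope ring_scope.

Definition is_max (disp : Order.disp_t) (T : porderType disp)
  (A : T -> Prop) (x : T) : Prop := A x /\ forall y, A y -> (y <= x)%O.

Definition is_min (disp : Order.disp_t) (T : porderType disp)
  (A : T -> Prop) (x : T) : Prop := A x /\ forall y, A y -> (x <= y)%O.

Definition graded_monomial_order (s : nat) (le : rel 'X_{1..s}) : Prop :=
  [/\ total le, antisymmetric le & transitive le] /\
  [/\ forall m : 'X_{1..s}, le 0%MM m,
      forall m m1 m2 : 'X_{1..s}, le m1 m2 -> le (m1 + m)%MM (m2 + m)%MM
    & forall m1 m2 : 'X_{1..s}, (mdeg m1 < mdeg m2)%N -> le m1 m2].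

Section Ideals.
Variables (K : fieldType) (s : nat).
Local Notation S := {mpoly K[s]}.

(* [msize f] is one more than the total degree, and [msize 0 = 0]. *)
Definition deg_le (d : nat) (f : S) : Prop := (msize f <= d.+1)%N.

Definition ideal_gen (G : S -> Prop) (f : S) : Prop :=
  exists (n : nat) (a g : 'I_n -> S),
    (forall i, G (g i)) /\ f = \sum_(i < n) a i * g i.

Definition ideal_add (I : S -> Prop) (F : seq S) : S -> Prop :=
  ideal_gen (fun f => I f \/ f \in F).

(* Dimension of V / (V ∩ W) for linear subspaces V and W of S, as the size of
   a family in V whose classes form a basis. *)
Definition is_quotient_dim (V W : S -> Prop) (n : nat) : Prop :=
  exists b : 'I_n -> S,
    [/\ forall i, V (b i),
        forall c : 'I_n -> K, W (\sum_(i < n) c i *: b i) -> forall i, c i = 0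
      & forall f, V f -> exists c : 'I_n -> K, W (f - \sum_(i < n) c i *: b i)].

(* The dimension exists and is unique for every ideal J. *)
Definition affine_hilbert (J : S -> Prop) (d : nat) : nat :=
  epsilon (inhabits 0%N)
    (is_quotient_dim (deg_le d) (fun f => J f /\ deg_le d f)).

(* Chains P_0 < ... < P_k of prime ideals of S / J, seen as prime ideals of S
   containing J; [idealr_closed] includes properness. *)
Definition prime_chain (J : S -> Prop) (k : nat) : Prop :=
  exists P : nat -> {pred S},
    (forall i, (i <= k)%N ->
       [/\ idealr_closed (P i), prime_idealr_closed (P i)
         & forall f, J f -> f \in P i]) /\
    (forall i, (i < k)%N ->
       {subset P i <= P i.+1} /\ exists2 f, f \in P i.+1 & f \notin P i).

Definition is_krull_dim (J : S -> Prop) (k : nat) : Prop :=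
  is_max (prime_chain J) k.

Definition is_degree (J : S -> Prop) (e : rat) : Prop :=
  (J 1 /\ e = 0) \/
  (~ J 1 /\
   exists (k : nat) (h : {poly rat}),
     [/\ is_krull_dim J k,
         exists d0 : nat, forall d : nat, (d0 <= d)%N ->
           (affine_hilbert J d)%:R = h.[d%:R],
         size h = k.+1
       & e = k`!%:R * lead_coef h]).

(* deg(S/J); [is_degree J] has exactly one solution for every ideal J, by the
   theorem on the affine Hilbert polynomial. *)
Definition degree (J : S -> Prop) : rat := epsilon (inhabits 0) (is_degree J).

Section Order.
Variable le : rel 'X_{1..s}.

(* The largest monomial of f for [le], meaningful when f != 0. *)
Definition in_mon (f : S) : 'X_{1..s} := last 0%MM (sort le (msupp f)).

Definition initial_ideal (I : S -> Prop) : S -> Prop :=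
  ideal_gen (fun g => exists f, [/\ I f, f != 0 & g = 'X_[in_mon f]]).

Definition standard_monomial (I : S -> Prop) (m : 'X_{1..s}) : Prop :=
  ~ initial_ideal I 'X_[m].

Definition standard_poly (I : S -> Prop) (f : S) : Prop :=
  f != 0 /\ forall m, m \in msupp f -> standard_monomial I m.

(* Here [monic] from the library is about univariate polynomials only. *)
Definition monic_for (f : S) : Prop := f@_(in_mon f) = 1.

(* Sets {f_1, ..., f_r} are enumerated by r-tuples: distinct initial monomials
   make the entries distinct. *)
Definition family_F (I : S -> Prop) (d r : nat) (F : r.-tuple S) : Prop :=
  (forall f, f \in F -> [/\ deg_le d f, standard_poly I f & monic_for f]) /\
  uniq [seq in_mon f | f <- F].

End Order.
End Ideals.

Section Codes.
Variable K : finFieldType.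

Definition vanishing_ideal (s : nat) (X : {set {ffun 'I_s -> K}})
  (f : {mpoly K[s]}) : Prop := forall P, P \in X -> f.@[P] = 0.

Definition RM_code (s : nat) (X : {set {ffun 'I_s -> K}}) (d : nat)
  (v : 'rV[K]_#|X|) : Prop :=
  exists2 f : {mpoly K[s]}, deg_le d f & v = \row_(i < #|X|) f.@[enum_val i].

Definition code_supp (m : nat) (D : {vspace 'rV[K]_m}) : {set 'I_m} :=
  [set i | [exists a : 'rV[K]_m, (a \in D) && (a 0 i != 0)]].

Definition is_gen_hamming_weight (m : nat) (C : 'rV[K]_m -> Prop)
  (r delta : nat) : Prop :=
  is_min (fun w : nat => exists D : {vspace 'rV[K]_m},
    [/\ forall a, a \in D -> C a, \dim D = r & w = #|code_supp D|]) delta.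

End Codes.

Arguments RM_code {K s} X d v.

(* Main.v *)
From HB Require Import structures.
Require Import Defs.
From mathcomp Require Import all_boot all_order all_algebra.
From Stdlib Require Import ClassicalEpsilon FunctionalExtensionality PropExtensionality.

Import GRing.Theory.
Local Open Scope ring_scope.

(* An ideal J containing I = I(X) is the vanishing ideal of V(J), a subset of
   X, and the degree of S/I(V) is |V|. Hence deg(S/I) - deg(S/(I,F)) is the
   number of points of X at which some element of F does not vanish, which is
   the size of the support of the subcode spanned by the evaluations of F.
   It remains to see that these subcodes, for F in the family, are exactly the
   r-dimensional ones. Standard polynomials with distinct initial monomials are
   independent modulo I. Conversely, every codeword is the evaluation of a
   standard polynomial of degree at most d because the order is graded, and
   choosing one monic standard polynomial for each initial monomial that occurs
   in a subcode D gives, by elimination, a basis of D. *)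

(** * Initial monomials and reduction modulo an ideal *)

Section MonomialOrder.
Set Implicit Arguments.
Unset Strict Implicit.
Variables (K : fieldType) (s : nat) (le : rel 'X_{1..s}).
Hypothesis hle : graded_monomial_order le.
Local Notation S := {mpoly K[s]}.

Let le_total : total le. Proof. by case: hle => -[]. Qed.
Let le_anti : antisymmetric le. Proof. by case: hle => -[]. Qed.
Let le_trans : transitive le. Proof. by case: hle => -[]. Qed.
Let le_refl : reflexive le.
Proof. by move=> m; case/orP: (le_total m m). Qed.
Let le_add m m1 m2 : le m1 m2 -> le (m1 + m)%MM (m2 + m)%MM.
Proof. by case: hle => _ [_ h _]; apply: h. Qed.

Lemma graded_mdeg_le m1 m2 : le m1 m2 -> (mdeg m1 <= mdeg m2)%N.
Proof.
move=> h; rewrite leqNgt; apply/negP => hlt; case: hle => _ [_ _ hd].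
have e : m1 = m2 by apply: le_anti; rewrite h hd.
by rewrite e ltnn in hlt.
Qed.

Lemma deg_leP d (f : S) :
  deg_le d f <-> (forall m, m \in msupp f -> (mdeg m <= d)%N).
Proof.
rewrite /deg_le msizeE; split=> [h m hm|h].
  by rewrite -ltnS; apply: leq_trans h; apply: leq_bigmax_seq.
by apply/bigmax_leqP_seq => m hm _; rewrite ltnS h.
Qed.

Lemma last_sorted_max (T : eqType) (R : rel T) x0 (l : seq T) :
  reflexive R -> transitive R -> sorted R l ->
  forall x, x \in l -> R x (last x0 l).
Proof.
move=> Rr Rt; case: l => // a l /= hp; elim: l a hp => [|b l IH] a /= => [_|/andP [hab hp]] x.
  by rewrite inE => /eqP ->.
rewrite in_cons => /orP [/eqP ->|]; last exact: IH.
by apply: Rt hab _; apply: IH => //; rewrite mem_head.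
Qed.

Lemma in_mon_supp (f : S) : f != 0 -> in_mon le f \in msupp f.
Proof.
move=> hf; rewrite /in_mon -(mem_sort le).
have : sort le (msupp f) != [::].
  by rewrite -size_eq0 size_sort size_eq0 msupp_eq0.
by case: (sort le _) => //= a l _; apply: mem_last.
Qed.

Lemma in_mon_max (f : S) m : m \in msupp f -> le m (in_mon le f).
Proof.
rewrite -(mem_sort le) => hm; apply: last_sorted_max hm => //.
exact: sort_sorted.
Qed.

Lemma in_mon_eq (f : S) m :
  m \in msupp f -> (forall m', m' \in msupp f -> le m' m) -> in_mon le f = m.
Proof.
move=> hm hmax; apply: le_anti; rewrite in_mon_max // andbT.
apply/hmax/in_mon_supp; apply: contraTneq hm => ->.
by rewrite msupp0.
Qed.

Lemma in_monMX (f : S) m : f != 0 -> in_mon le (f * 'X_[m]) = (in_mon le f + m)%MM.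
Proof.
move=> hf; apply: in_mon_eq => [|m'].
  by rewrite mcoeff_msupp addmC mcoeffMX -mcoeff_msupp in_mon_supp.
rewrite (perm_mem (msuppMX _ _)) => /mapP [m1 h ->].
by rewrite addmC; apply/le_add/in_mon_max.
Qed.

Definition ideal (I : S -> Prop) : Prop :=
  [/\ I 0, forall f g, I f -> I g -> I (f + g) & forall a f, I f -> I (a * f)].

(** Some product [a i * g i] must contain [m], so [m] is a multiple of an initial monomial of [I];
    multiplication by the cofactor stays in [I] and shifts the initial monomial to [m]. *)
Lemma nonstandard_monomialP I m : ideal I -> ~ standard_monomial le I m ->
  exists h, [/\ I h, h != 0 & in_mon le h = m].
Proof.
move=> [_ _ IM] /NNPP [n [a [g [hg e]]]].
have : ('X_[m] : S)@_m != 0 by rewrite mcoeffX eqxx oner_eq0.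
rewrite e raddf_sum /= => hs.
have [i hi] : exists i, (a i * g i)@_m != 0.
  apply: NNPP => hN; case/eqP: hs; apply: big1 => i _.
  by apply/eqP/negPn/negP => hi; apply: hN; exists i.
have [f [If f0 gE]] := hg i.
move: hi; rewrite gE -mcoeff_msupp (perm_mem (msuppMX _ _)) => /mapP [m1 _ ->].
exists ('X_[m1] * f); split; first exact: IM.
  rewrite mulf_neq0 // -msupp_eq0 msuppX //.
by rewrite mulrC in_monMX.
Qed.

Lemma in_mon_nonstandard I (f : S) :
  I f -> f != 0 -> ~ standard_monomial le I (in_mon le f).
Proof.
move=> If f0; apply; exists 1%N, (fun=> 1), (fun=> 'X_[in_mon le f]).
by split=> [_|]; [exists f | rewrite big_ord1 mul1r].
Qed.

Lemma deg_le_lin d c (f g : S) : deg_le d f -> deg_le d g -> deg_le d (c *: f + g).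
Proof.
move=> /deg_leP hf /deg_leP hg; apply/deg_leP => m /msuppD_le.
by rewrite mem_cat => /orP [/msuppZ_le/hf|/hg].
Qed.

Lemma deg_le_in_mon d (f : S) : f != 0 -> (mdeg (in_mon le f) <= d)%N -> deg_le d f.
Proof.
move=> f0 h; apply/deg_leP => m hm; apply: leq_trans h.
exact/graded_mdeg_le/in_mon_max.
Qed.

(** Induction measure: only finitely many monomials have degree at most [d], so descent along [le]
    becomes descent in [nat]. *)
Definition mon_rank d (m : 'X_{1..s}) : nat :=
  #|[set m' : 'X_{1..s < d.+1} | le m' m]|.

Lemma mon_rank_lt d m m' : (mdeg m <= d)%N -> le m' m -> m' != m ->
  (mon_rank d m' < mon_rank d m)%N.
Proof.
move=> hm hle' ne; apply: proper_card; apply/properP; split.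
  apply/subsetP => x; rewrite !inE => h; exact: le_trans hle'.
have hb : (mdeg m < d.+1)%N by [].
exists (BMultinom hb); rewrite inE /= ?le_refl //.
by apply: contra ne => h; apply/eqP/le_anti; rewrite hle' h.
Qed.

(** Descent on the initial monomial. The form of the hypothesis on [g] suits the subtraction of any
    multiple of a polynomial with the same initial monomial, as in [cancel_in_mon]. *)
Lemma leading_term_ind d (P : S -> Prop) :
  P 0 ->
  (forall f, f != 0 -> deg_le d f ->
     (forall g, deg_le d g -> {subset msupp g <= [pred m | le m (in_mon le f)]} ->
        g@_(in_mon le f) = 0 -> P g) -> P f) ->
  forall f, deg_le d f -> P f.
Proof.
move=> P0 IH.
(* For [f = 0] the initial monomial is a default value, so the rank is bounded only when
   [f != 0]. *)
have : forall n f, deg_le d f -> (f != 0 -> (mon_rank d (in_mon le f) < n)%N) -> P f.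
  elim=> [|n IHn] f hd hf.
    by case: (eqVneq f 0) => [->//|/hf].
  case: (eqVneq f 0) => [->//|f0]; apply: IH => // g hgd hgs hg0.
  apply: IHn => // g0; move: (hf f0); rewrite ltnS; apply: leq_trans.
  apply: mon_rank_lt.
  - by move/deg_leP: hd; apply; apply: in_mon_supp.
  - exact/hgs/in_mon_supp.
  - by apply: contraTneq (in_mon_supp g0) => ->; rewrite mcoeff_msupp hg0 eqxx.
by move=> h f hd; apply: (h (mon_rank d (in_mon le f)).+1).
Qed.

Lemma cancel_in_mon (f h : S) : f != 0 -> h != 0 -> in_mon le h = in_mon le f ->
  let c := f@_(in_mon le f) / h@_(in_mon le f) in
  {subset msupp (f - c *: h) <= [pred m | le m (in_mon le f)]} /\
  (f - c *: h)@_(in_mon le f) = 0.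
Proof.
move=> f0 h0 e c; split=> [m /msuppB_le|].
  rewrite mem_cat inE => /orP [/in_mon_max//|/msuppZ_le/in_mon_max].
  by rewrite e.
have : h@_(in_mon le f) != 0 by rewrite -e -mcoeff_msupp in_mon_supp.
by move=> hc; rewrite mcoeffB mcoeffZ divfK // subrr.
Qed.

(** Division algorithm: the leading term is either kept, when standard, or cancelled by an element
    of [I]. Gradedness keeps every intermediate polynomial within degree [d]. *)
Lemma normal_form I d (f : S) : ideal I -> deg_le d f ->
  exists g, [/\ I (f - g), deg_le d g &
    forall m, m \in msupp g -> standard_monomial le I m].
Proof.
move=> idI; have [I0 ID IM] := idI; move: f; apply: leading_term_ind.
  by exists 0; rewrite subrr; split=> // [|m]; rewrite ?msupp0 // /deg_le msize0.
move=> f f0 hd IH; set m := in_mon le f.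
have hmd : (mdeg m <= d)%N by move/deg_leP: hd; apply; apply: in_mon_supp.
have [st|/(nonstandard_monomialP idI) [h [Ih h0 hm]]] := classic (standard_monomial le I m).
  have X0 : ('X_[m] : S) != 0 by rewrite -msupp_eq0 msuppX.
  have Xm : in_mon le ('X_[m] : S) = m.
    by apply: in_mon_eq => [|m']; rewrite msuppX inE // => /eqP ->.
  have hdX : deg_le d ('X_[m] : S) by apply: deg_le_in_mon => //; rewrite Xm.
  have [hs hc] := cancel_in_mon f0 X0 Xm.
  set c := _ / _ in hs hc.
  have [|g [Ig gd gs]] := IH _ _ hs hc.
    by rewrite -scaleNr addrC; apply: deg_le_lin.
  exists (c *: 'X_[m] + g); split; first by rewrite opprD addrA.
    exact: deg_le_lin.
  move=> m' /msuppD_le; rewrite mem_cat => /orP [/msuppZ_le|/gs //].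
  by rewrite msuppX inE => /eqP ->.
have [hs hc] := cancel_in_mon f0 h0 hm.
set c := _ / _ in hs hc.
have [|g [Ig gd gs]] := IH _ _ hs hc.
  (* In a graded order no monomial of [h] has degree above that of its initial monomial, which is
     [m]. *)
  rewrite -scaleNr addrC; apply: deg_le_lin => //.
  by apply: deg_le_in_mon => //; rewrite hm.
exists g; split=> //.
have -> : f - g = f - c *: h - g + c%:MP * h by rewrite mul_mpolyC addrAC subrK.
by apply: ID => //; apply: IM.
Qed.

(** Otherwise the sum is nonzero and its initial monomial is nonstandard, as the sum lies in [I];
    but that monomial occurs in some [F j], so it is standard. *)
Lemma standard_comb_not_in I r (F : 'I_r -> S) (c : 'I_r -> K) :
  (forall i, standard_poly le I (F i)) -> injective (fun i => in_mon le (F i)) ->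
  I (\sum_i c i *: F i) -> forall i, c i = 0.
Proof.
move=> hF inj Ip i0; apply/eqP/negPn/negP => hi0; set p := \sum_i _ in Ip.
(* With the order reversed, this picks the largest initial monomial among the terms with nonzero
   coefficient; no other term can cancel it. *)
have [i hi hmax] := @extremumP _ _ (fun x y => le y x) i0 (fun i => c i != 0)
  (fun i => in_mon le (F i)) (fun x => le_refl x)
  (fun y x z h1 h2 => le_trans h2 h1) (fun x y => le_total y x) hi0.
have pi : p@_(in_mon le (F i)) != 0.
  rewrite raddf_sum /= (bigD1 i) //= big1 ?addr0 => [|j ne].
    rewrite mcoeffZ mulf_neq0 // -mcoeff_msupp in_mon_supp //.
    by case: (hF i).
  rewrite mcoeffZ; case: (eqVneq (c j) 0) => [->|cj]; first by rewrite mul0r.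
  rewrite memN_msupp_eq0 ?mulr0 //; apply: contra ne => /in_mon_max h.
  by apply/eqP/inj/le_anti; rewrite h hmax.
have p0 : p != 0 by apply: contraNneq pi => ->; rewrite mcoeff0.
apply: (in_mon_nonstandard Ip p0).
have /msupp_sum_le /flatten_mapP [j _] := in_mon_supp p0.
by move=> /msuppZ_le; case: (hF j) => _; apply.
Qed.

End MonomialOrder.

(** * Generated ideals and spans *)

Section IdealGen.
Set Implicit Arguments.
Unset Strict Implicit.
Variables (K : fieldType) (s : nat) (G : {mpoly K[s]} -> Prop).

Lemma ideal_gen_ideal : ideal (ideal_gen G).
Proof.
split.
- by exists 0%N, (fun=> 0), (fun=> 0); split=> [[]//|]; rewrite big_ord0.
- move=> f g [n1 [a1 [g1 [h1 ->]]]] [n2 [a2 [g2 [h2 ->]]]].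
  exists (n1 + n2)%N, (fun i => match split i with inl j => a1 j | inr j => a2 j end),
    (fun i => match split i with inl j => g1 j | inr j => g2 j end).
  split=> [i|]; first by case: (split i).
  rewrite big_split_ord; congr (_ + _); apply: eq_bigr => i _.
    by rewrite (unsplitK (inl i) : split (lshift _ i) = _).
  by rewrite (unsplitK (inr i) : split (rshift _ i) = _).
- move=> a f [n [b [g [h ->]]]]; exists n, (fun i => a * b i), g; split=> //.
  by rewrite big_distrr; apply: eq_bigr => i _ /=; rewrite mulrA.
Qed.

Lemma ideal_gen_sub f : G f -> ideal_gen G f.
Proof. by move=> hf; exists 1%N, (fun=> 1), (fun=> f); rewrite big_ord1 mul1r. Qed.

Lemma ideal_sum (I : {mpoly K[s]} -> Prop) (T : Type) (l : seq T) (P : pred T)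
  (F : T -> {mpoly K[s]}) :
  ideal I -> (forall i, P i -> I (F i)) -> I (\sum_(i <- l | P i) F i).
Proof. by move=> [I0 ID _]; apply: big_ind. Qed.

End IdealGen.

Lemma span_ind (F : fieldType) (vT : vectType F) (l : seq vT) (P : vT -> Prop) :
  P 0 -> (forall a u v, P u -> P v -> P (a *: u + v)) ->
  (forall u, u \in l -> P u) -> forall v, v \in <<l>>%VS -> P v.
Proof.
move=> P0 PL; elim: l => [|x l IH] hl v.
  by rewrite span_nil memv0 => /eqP ->.
rewrite span_cons => /memv_addP [_ /vlineP [a ->]] [w hw ->].
apply: PL; first by apply: hl; rewrite mem_head.
by apply: IH hw => u hu; apply: hl; rewrite in_cons hu orbT.
Qed.

(** * Vanishing ideals of finite point sets *)

Section Vanishing.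
Set Implicit Arguments.
Unset Strict Implicit.
Variables (K : finFieldType) (s : nat).
Local Notation S := {mpoly K[s]}.
Local Notation point := {ffun 'I_s -> K}.
Implicit Types (X V : {set point}) (f g : S) (P Q : point).

Lemma vanishing_idealP X : ideal (vanishing_ideal X).
Proof.
split=> [P _|f g hf hg P hP|a f hf P hP]; first exact: meval0.
  by rewrite mevalD hf // hg // addr0.
by rewrite mevalM hf // mulr0.
Qed.

(** Finiteness of [K] allows a product over all wrong values of each coordinate; [P] is the only
    point of affine space where no factor vanishes. *)
Definition sep_poly P : S := \prod_i \prod_(c : K | c != P i) ('X_i - c%:MP).

Lemma sep_polyE P Q : (sep_poly P).@[Q] == 0 = (Q != P).
Proof.
rewrite /sep_poly rmorph_prod /=.
under eq_bigr => i _ do rewrite rmorph_prod /=.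
under eq_bigr => i _ do under eq_bigr => c _ do rewrite mevalB mevalXU mevalC.
apply/idP/idP => [/prodf_eq0 [i _ /prodf_eq0 [c hc]]|ne].
  by rewrite subr_eq0 => /eqP e; apply: contraNneq hc => <-; rewrite e.
have [i hi] : exists i, Q i != P i.
  apply/existsP; rewrite -negb_forall; apply: contra ne => /forallP h.
  by apply/eqP/ffunP => i; apply/eqP.
by apply/prodf_eq0; exists i => //; apply/prodf_eq0; exists (Q i); rewrite ?subrr.
Qed.

Definition indicator P : S := (sep_poly P).@[P]^-1 *: sep_poly P.

Lemma indicatorE P Q : (indicator P).@[Q] = (Q == P)%:R.
Proof.
rewrite /indicator mevalZ; case: (eqVneq Q P) => [->|ne].
  by rewrite mulVf // sep_polyE eqxx.
by move: ne; rewrite -sep_polyE => /eqP ->; rewrite mulr0.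
Qed.

Definition zero_locus X (F : seq S) : {set point} :=
  [set P in X | all (fun f : S => f.@[P] == 0) F].

(* An ideal J containing I(X) is radical: for P in X outside V(J), pick g in J
   with g(P) != 0; then the indicator of P agrees with a multiple of g on X. *)
Lemma ideal_add_vanishing X (F : seq S) :
  ideal_add (vanishing_ideal X) F = vanishing_ideal (zero_locus X F).
Proof.
apply: functional_extensionality => f; apply: propositional_extensionality.
split=> [[n [a [g [hg ->]]]] P|hf].
  rewrite inE => /andP [hP /allP hF]; rewrite raddf_sum /= big1 // => i _.
  rewrite mevalM; case: (hg i) => [->|/hF /eqP ->] //; exact: mulr0.
have idJ := ideal_gen_ideal (fun f => vanishing_ideal X f \/ f \in F).
have [J0 JD JM] := idJ.
have JI h : vanishing_ideal X h -> ideal_add (vanishing_ideal X) F h.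
  by move=> hI; apply: ideal_gen_sub; left.
(* [p] interpolates [f] on [X] off the zero locus. As [f] is zero on the locus, [f - p] vanishes on
   [X]; it remains to put each indicator in the ideal. *)
pose p := \sum_(P in X :\: zero_locus X F) f.@[P] *: indicator P.
rewrite -(subrK p f); apply: (JD).
  apply: JI => Q hQ; rewrite mevalB /p (raddf_sum (meval Q)) /=.
  under eq_bigr => P _ do rewrite mevalZ indicatorE.
  case: (boolP (Q \in zero_locus X F)) => hQV.
    rewrite hf // sub0r big1 ?oppr0 // => P; rewrite inE => /andP [hP _].
    by rewrite (_ : Q == P = false) ?mulr0 //; apply: contraNF hP => /eqP <-.
  rewrite (bigD1 Q) /=; last by rewrite in_setD hQV hQ.
  rewrite eqxx mulr1 big1 ?addr0 ?subrr // => P.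
  by case/andP => _ ne; rewrite eq_sym (negbTE ne) mulr0.
apply: ideal_sum => // P; rewrite inE => /andP [hPV hP].
rewrite -mul_mpolyC; apply: (JM).
have [g hg gP] : exists2 g, g \in F & g.@[P] != 0.
  by move: hPV; rewrite inE hP /= -has_predC => /hasP [g hg gP]; exists g.
pose h := (g.@[P]^-1 *: indicator P) * g.
rewrite -(subrK h (indicator P)); apply: JD; last first.
  by apply: JM; apply: ideal_gen_sub; right.
apply: JI => Q _; rewrite /h mevalB mevalM indicatorE mevalZ indicatorE.
case: (eqVneq Q P) => [->|_]; last by rewrite mulr0 mul0r subrr.
by rewrite mulr1 mulVf // subrr.
Qed.

(** * Evaluation, the affine Hilbert function and the degree *)

Definition ev X f : 'rV[K]_#|X| := \row_(i < #|X|) f.@[enum_val i].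

Fact ev_is_linear X : linear (ev X).
Proof. by move=> a f g; apply/rowP => i; rewrite !mxE mevalD mevalZ. Qed.
HB.instance Definition _ X :=
  GRing.isLinear.Build K S 'rV[K]_#|X| _ (ev X) (@ev_is_linear X).

Lemma ev_eq0 X f : ev X f = 0 <-> vanishing_ideal X f.
Proof.
split=> [e P hP|h]; last by apply/rowP => i; rewrite !mxE h // enum_valP.
by move/rowP: e => /(_ (enum_rank_in hP P)); rewrite !mxE enum_rankK_in.
Qed.

(** The code as a [{vspace}], so that dimension and bases are available, which the predicate
    [RM_code] does not offer. *)
Definition code_space X d : {vspace 'rV[K]_#|X|} :=
  <<[seq ev X 'X_[m] | m : 'X_{1..s < d.+1}]>>%VS.

Lemma code_spaceP X d v : v \in code_space X d <-> RM_code X d v.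
Proof.
split=> [|[f hf ->]].
  apply: span_ind => [|a u w [f hf ->] [g hg ->]|u /imageP [m _ ->]].
  - by exists 0; rewrite ?/deg_le ?msize0 // -[LHS](raddf0 (ev X)).
  - exists (a *: f + g); first exact: deg_le_lin.
    by rewrite -/(ev X f) -/(ev X g) -linearP.
  - by exists 'X_[m]; rewrite // /deg_le msizeX bmdeg.
rewrite -/(ev X f) (mpolywE hf) linear_sum; apply: memv_suml => m _.
by rewrite linearZ; apply/memvZ/memv_span/image_f.
Qed.

Lemma code_space_ev X d f : deg_le d f -> ev X f \in code_space X d.
Proof. by move=> hf; apply/code_spaceP; exists f. Qed.

(** Evaluation has kernel I(X), so it identifies the quotient with the code: bases are pushed
    forward in one direction and lifted in the other. *)
Lemma quotient_dim_code X d n :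
  is_quotient_dim (@deg_le K s d) (fun f => vanishing_ideal X f /\ deg_le d f) n
  <-> n = \dim (code_space X d).
Proof.
have dsum m (b : 'I_m -> S) (c : 'I_m -> K) : (forall i, deg_le d (b i)) ->
    deg_le d (\sum_i c i *: b i).
  move=> hb; apply: big_ind => [|f g|i _]; first by rewrite /deg_le msize0.
    by rewrite -{2}[f]scale1r; apply: deg_le_lin.
  by rewrite -[_ *: _]addr0; apply: deg_le_lin; rewrite // /deg_le msize0.
split=> [[b [hb hfree hspan]]|->].
  pose B := [tuple ev X (b i) | i < n].
  have BE (i : 'I_n) : B`_i = ev X (b i) by rewrite -tnth_nth tnth_mktuple.
  have fB : free B.
    apply/freeP => k hk; apply: hfree; split; last exact: dsum.
    apply/ev_eq0; rewrite linear_sum -[RHS]hk; apply: eq_bigr => i _.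
    by rewrite linearZ BE.
  rewrite -{1}(size_tuple B) -(eqP fB); congr (\dim _).
  apply/eqP; rewrite eqEsubv; apply/andP; split.
    by apply/span_subvP => v /mapP [i _ ->]; apply: code_space_ev.
  apply/subvP => v /code_spaceP [f hf ->].
  have [c [/ev_eq0 hc _]] := hspan f hf; rewrite -/(ev X f).
  move/eqP: hc; rewrite linearB subr_eq0 => /eqP ->.
  rewrite linear_sum; apply: memv_suml => i _; rewrite linearZ /= -BE.
  by apply/memvZ/memv_span/mem_nth; rewrite size_tuple.
pose B := vbasis (code_space X d).
have /fin_all_exists2 [b hb bE] : forall i : 'I_(\dim (code_space X d)),
    exists2 f, deg_le d f & B`_i = ev X f.
  by move=> i; apply/code_spaceP/vbasis_mem/mem_nth; rewrite size_tuple.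
have hB := vbasisP (code_space X d).
exists b; split=> // [c [/ev_eq0 hc _]|f hf].
  move: (basis_free hB) => /freeP; apply; rewrite -[RHS]hc linear_sum.
  by apply: eq_bigr => i _; rewrite linearZ /= -bE.
exists (fun i => coord B i (ev X f)); split; last first.
  by rewrite addrC -scaleN1r -[_ + f]/(_ *: _ + f); apply: deg_le_lin; auto.
apply/ev_eq0/eqP; rewrite linearB subr_eq0 eq_sym; apply/eqP.
rewrite [RHS](coord_basis hB (code_space_ev X hf)) (linear_sum (ev X)).
by apply: eq_bigr => i _; rewrite linearZ /= -bE.
Qed.

(** [quotient_dim_code] gives existence and uniqueness at once, which determines the [epsilon]. *)
Lemma affine_hilbert_vanishing X d :
  affine_hilbert (vanishing_ideal X) d = \dim (code_space X d).
Proof.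
apply/quotient_dim_code; apply: epsilon_spec.
by exists (\dim (code_space X d)); apply/quotient_dim_code.
Qed.

(** Once [d] reaches the degrees of all indicators, their evaluations provide every unit vector and
    the code is the whole space. *)
Lemma affine_hilbert_large X : exists d0, forall d, (d0 <= d)%N ->
  affine_hilbert (vanishing_ideal X) d = #|X|.
Proof.
exists (\max_P msize (indicator P)) => d hd.
rewrite affine_hilbert_vanishing.
suff -> : code_space X d = fullv by rewrite dimvf /dim /= mul1n.
apply/eqP; rewrite eqEsubv subvf; apply/subvP => v _.
rewrite (row_sum_delta v); apply: memv_suml => i _; apply: memvZ.
have -> : delta_mx 0 i = ev X (indicator (enum_val i)).
  by apply/rowP => j; rewrite !mxE indicatorE (inj_eq enum_val_inj).
apply/code_space_ev/leqW/(leq_trans _ hd).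
exact: (leq_bigmax (F := fun P => msize (indicator P))).
Qed.

(* Primes containing I(X): as the product of the indicators of two distinct
   points is in I(X), all but one of the indicators lie in the prime. *)
Lemma prime_over_vanishing X (p : {pred S}) :
  idealr_closed p -> prime_idealr_closed p ->
  (forall f, vanishing_ideal X f -> f \in p) ->
  exists P, forall f, (f \in p) = (f.@[P] == 0).
Proof.
move=> [p0 p1 pL] pP hp.
have pD f g : f \in p -> g \in p -> f + g \in p.
  by move=> hf hg; rewrite -[f]mul1r; apply: pL.
have pM a f : f \in p -> a * f \in p.
  by move=> hf; rewrite -[_ * _]addr0; apply: pL.
have [P hPX hP] : exists2 P, P \in X & indicator P \notin p.
  apply: NNPP => hN; case/negP: p1.
  rewrite -(subrK (\sum_(P in X) indicator P) 1); apply: (pD).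
    apply: hp => Q hQ; rewrite mevalB meval1 (raddf_sum (meval Q)) /=.
    under eq_bigr => P _ do rewrite indicatorE.
    rewrite (bigD1 Q) //= eqxx big1 ?addr0 ?subrr // => P /andP [_ ne].
    by rewrite eq_sym (negbTE ne).
  apply: (big_ind (fun f => f \in p) p0 pD) => P hP.
  by case: (boolP (indicator P \in p)) => // h; case: hN; exists P.
exists P => f; apply/idP/eqP => [fp|fP].
  apply/eqP; apply: contraNT hP => fP.
  rewrite -(subrK ((f.@[P]^-1 *: indicator P) * f) (indicator P)).
  apply: pD; last exact: pM.
  apply: hp => Q _; rewrite mevalB mevalM indicatorE mevalZ indicatorE.
  case: (eqVneq Q P) => [->|_]; last by rewrite mulr0 mul0r subrr.
  by rewrite mulr1 mulVf // subrr.
have : indicator P * f \in p.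
  apply: hp => Q _; rewrite mevalM indicatorE.
  by case: (eqVneq Q P) => [->|_]; rewrite ?fP ?mulr0 ?mul0r.
by case/pP/orP => // h; rewrite h in hP.
Qed.

(** A prime above I(X) is the ideal of a single point, and no such ideal strictly contains
    another. *)
Lemma krull_dim_vanishing X : X != set0 -> is_krull_dim (vanishing_ideal X) 0.
Proof.
case/set0Pn => P0 hP0; split.
  exists (fun=> fun f : S => f.@[P0] == 0); split=> // i _; split=> [||f hf].
  - split; rewrite ?unfold_in ?meval0 ?meval1 ?oner_eq0 // => a u v.
    by rewrite !unfold_in mevalD mevalM => /eqP -> /eqP ->; rewrite mulr0 addr0.
  - by move=> u v; rewrite !unfold_in mevalM mulf_eq0.
  - by rewrite unfold_in hf.
case=> // k [p [hprime hchain]].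
have hp i : (i <= k.+1)%N -> exists P, forall f, (f \in p i) = (f.@[P] == 0).
  by case/hprime; apply: prime_over_vanishing.
have [P hP] := hp 0%N isT; have [Q hQ] := hp 1%N isT.
have [sub [f]] := hchain 0%N isT; rewrite hP hQ => /eqP fQ.
(* This polynomial vanishes only at [P], so the inclusion forces [Q = P], against strictness. *)
have : 1 - indicator P \in p 1%N.
  by apply: sub; rewrite hP mevalB meval1 indicatorE eqxx subrr.
rewrite hQ mevalB meval1 indicatorE; case: (eqVneq Q P) => [<-|_].
  by rewrite fQ eqxx.
by rewrite subr0 oner_eq0.
Qed.

(** In dimension zero the Hilbert polynomial is a constant, equal to the eventual value of the
    Hilbert function. The empty [X] falls under the clause for the unit ideal. *)
Lemma degree_vanishing X : degree (vanishing_ideal X) = #|X|%:R.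
Proof.
have [d0 hd0] := affine_hilbert_large X.
have key e : is_degree (vanishing_ideal X) e <-> e = #|X|%:R.
  have [X0|X0] := eqVneq X set0.
    have h1 : vanishing_ideal X 1 by rewrite X0 => P; rewrite inE.
    by rewrite {2}X0 cards0; split=> [[[]|[]]|] //; left.
  have [P0 hP0] := set0Pn _ X0.
  have h1 : ~ vanishing_ideal X 1.
    by move/(_ P0 hP0)/eqP; rewrite meval1 oner_eq0.
  split=> [[[]//|[_ [k [h [[hk hmax] [d1 hd1] sh ->]]]]]|->]; last first.
    right; split=> //; exists 0%N, (#|X|%:R)%:P; split.
    - exact: krull_dim_vanishing.
    - by exists d0 => d hd; rewrite hornerC hd0.
    - by rewrite size_polyC Num.Theory.pnatr_eq0 cards_eq0 X0.
    - by rewrite lead_coefC mul1r.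
  have k0 : k = 0%N.
    have [_ /(_ k hk)] := krull_dim_vanishing X0.
    by rewrite Order.NatOrder.leEnat leqn0 => /eqP.
  rewrite {k hk hmax}k0 in sh *.
  have /size_poly1P [c c0 hc] : size h == 1%N by rewrite sh.
  (* At [maxn d0 d1] both descriptions of the Hilbert function are valid. *)
  move: (hd1 _ (leq_maxr d0 d1)); rewrite hd0 ?leq_maxl // => ->.
  by rewrite hc lead_coefC hornerC mul1r.
by apply/key; apply: epsilon_spec; exists #|X|%:R; apply/key.
Qed.

End Vanishing.

(** * Subcodes and families of standard monic polynomials *)

Section Main.
Set Implicit Arguments.
Unset Strict Implicit.
Variables (K : finFieldType) (s : nat) (X : {set {ffun 'I_s -> K}}).
Local Notation S := {mpoly K[s]}.
Local Notation I := (vanishing_ideal X).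

(** A coordinate is zero on the whole span as soon as it is zero on the generators, that is, when
    its point is in the zero locus. *)
Lemma card_code_supp_span (F : seq S) :
  #|code_supp <<[seq ev X f | f <- F]>>| = (#|X| - #|zero_locus X F|)%N.
Proof.
set D := span _.
have suppE (i : 'I_#|X|) :
    (i \in code_supp D) = (enum_val i \notin zero_locus X F).
  rewrite !inE enum_valP /= -has_predC.
  apply/existsP/hasP => [[a /andP [aD ai]]|[f hf hfi]]; last first.
    exists (ev X f); rewrite memv_span ?mxE //; exact: map_f.
  apply: NNPP => hN; case/eqP: ai; move: a aD.
  apply: span_ind => [|c u v hu hv|u /mapP [f hf ->]]; rewrite !mxE //.
    by rewrite hu hv mulr0 addr0.
  by apply/eqP/negPn/negP => h; apply: hN; exists f.
have -> : (#|X| - #|zero_locus X F| = #|X :\: zero_locus X F|)%N.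
  rewrite cardsD; congr (_ - #|pred_of_set _|)%N; apply/setP => P.
  by rewrite !inE; case: (P \in X).
rewrite -(card_imset (mem (code_supp D)) enum_val_inj); apply: eq_card => P.
apply/imsetP/setDP => [[i hi ->]|[hP hPV]].
  by split; [exact: enum_valP | rewrite -suppE].
exists (enum_rank_in hP P); last by rewrite enum_rankK_in.
by move: (suppE (enum_rank_in hP P)); rewrite enum_rankK_in // hPV => h.
Qed.

Variable le : rel 'X_{1..s}.
Hypothesis hle : graded_monomial_order le.

Lemma free_standard (F : seq S) :
  (forall f, f \in F -> standard_poly le I f) ->
  uniq [seq in_mon le f | f <- F] -> free [seq ev X f | f <- F].
Proof.
move=> hF uF; have/freeP : forall k : 'I_(size F) -> K,
  \sum_(i < size F) k i *: (map_tuple (ev X) (in_tuple F))`_i = 0 ->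
  forall i, k i = 0; last exact.
move=> k hk; apply: (@standard_comb_not_in _ _ le hle I _ (fun i => F`_i)).
- by move=> i; apply/hF/mem_nth.
- move=> i j /= e; apply/val_inj/eqP.
  rewrite -(nth_uniq 0%MM _ _ uF) ?size_map ?ltn_ord //.
  by rewrite !(nth_map 0) ?ltn_ord // e.
apply/ev_eq0; rewrite linear_sum -[RHS]hk; apply: eq_bigr => i _.
by rewrite linearZ /= (nth_map 0) ?ltn_ord.
Qed.

Lemma monic_scale (f : S) : f != 0 ->
  exists2 c : K, c != 0 & monic_for le (c *: f) /\ in_mon le (c *: f) = in_mon le f.
Proof.
move=> f0; have hc : f@_(in_mon le f) != 0 by rewrite -mcoeff_msupp in_mon_supp.
exists (f@_(in_mon le f))^-1; first by rewrite invr_neq0.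
have e : in_mon le ((f@_(in_mon le f))^-1 *: f) = in_mon le f.
  apply: (in_mon_eq hle) => [|m /msuppZ_le]; last exact: in_mon_max.
  by rewrite mcoeff_msupp mcoeffZ mulVf ?oner_eq0.
by split; rewrite // /monic_for e mcoeffZ mulVf.
Qed.

(** One polynomial is chosen per initial monomial occurring in [D]. Distinctness gives freeness,
    cancelling leading terms gives generation, and together they fix the number of choices. *)
Lemma standard_monic_basis d (D : {vspace 'rV[K]_#|X|}) :
  (D <= code_space X d)%VS ->
  exists F : (\dim D).-tuple S,
    family_F le I d F /\ <<[seq ev X f | f <- F]>>%VS = D.
Proof.
move=> hD.
pose Q (m : 'X_{1..s < d.+1}) (g : S) :=
  [/\ deg_le d g, standard_poly le I g, monic_for le g, ev X g \in D
    & in_mon le g = m].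
pose A := [set m | excluded_middle_informative (exists g, Q m g)].
pose G m := epsilon (inhabits (0 : S)) (Q m).
have GP m : m \in A -> Q m (G m).
  by rewrite inE; case: excluded_middle_informative => // h _; apply: epsilon_spec.
pose F := [seq G m | m <- enum A].
have FP f : f \in F -> exists m, Q m f.
  by case/mapP => m; rewrite mem_enum => hm ->; exists m; apply: GP.
have uF : uniq [seq in_mon le f | f <- F].
  have -> : [seq in_mon le f | f <- F] = [seq val m | m <- enum A].
    by rewrite -map_comp; apply/eq_in_map => m; rewrite mem_enum => /GP [].
  by rewrite map_inj_uniq ?enum_uniq //; apply: val_inj.
have stF f : f \in F -> standard_poly le I f by case/FP => m [].
have spanF : <<[seq ev X f | f <- F]>>%VS = D.
  apply/eqP; rewrite eqEsubv; apply/andP; split.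
    by apply/span_subvP => _ /mapP [f /FP [m [_ _ _ hf _]] ->].
  apply/subvP => v vD.
  have /code_spaceP [f hf vE] := subvP hD v vD.
  rewrite {}vE -/(ev X f) in vD *.
  (* Reduction modulo I(X) leaves the codeword unchanged, so it may be represented by a standard
     [g]. *)
  have [g [/ev_eq0]] := normal_form hle (vanishing_idealP X) hf.
  move/eqP; rewrite linearB subr_eq0 /= => /eqP e hg gs; rewrite {f hf}e in vD *.
  move: g hg gs vD; apply: (leading_term_ind hle) => [_ _|g g0 hg IH gs gD].
    by rewrite linear0 mem0v.
  have hm : (mdeg (in_mon le g) < d.+1)%N.
    by rewrite ltnS; move/deg_leP: hg; apply; apply: in_mon_supp.
  have [c c0 [cmon cin]] := monic_scale g0.
  (* The monic multiple of [g] itself shows that this initial monomial occurs. *)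
  have hA : BMultinom hm \in A.
    rewrite inE; case: excluded_middle_informative => // -[]; exists (c *: g).
    split=> //; last by rewrite linearZ memvZ.
      by rewrite -[_ *: _]addr0; apply: deg_le_lin; rewrite // /deg_le msize0.
    split; first by rewrite scaler_eq0 negb_or c0.
    by move=> m /msuppZ_le/gs.
  have [hd [h0 hs] _ hhD hin] := GP _ hA.
  have [hsub h0c] := cancel_in_mon hle g0 h0 hin.
  set h := G _ in hd h0 hs hhD hin hsub h0c.
  set b := _ / _ in hsub h0c.
  have hF : ev X h \in <<[seq ev X f | f <- F]>>%VS.
    by apply/memv_span/map_f/map_f; rewrite mem_enum.
  have evZ : ev X (b *: h) = b *: ev X h by exact: linearZ.
  have evB : ev X (g - b *: h) = ev X g - b *: ev X h by rewrite -evZ; exact: linearB.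
  rewrite -(subrK (b *: ev X h) (ev X g)) -evB memvD ?memvZ //.
  apply: IH => //.
  - by rewrite -scaleNr addrC; apply: deg_le_lin.
  - by move=> m /msuppB_le; rewrite mem_cat => /orP [/gs|/msuppZ_le/hs].
  - by rewrite evB memvB ?memvZ.
have szF : size F == \dim D.
  by move/eqP: (free_standard stF uF); rewrite spanF size_map => ->.
exists (Tuple szF); split=> //; split=> [f hf|]; last exact: uF.
by have [m []] := FP f hf.
Qed.

End Main.

(** * Existence of the minimum weight, and the formula *)

Lemma ex_is_min_nat (P : nat -> Prop) : (exists n, P n) -> exists n, is_min P n.
Proof.
move=> [n Pn].
have exP : exists n, if excluded_middle_informative (P n) then true else false.
  by exists n; case: excluded_middle_informative.
case: (ex_minnP exP) => m; case: excluded_middle_informative => // Pm _ hm.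
exists m; split=> // k Pk; rewrite Order.NatOrder.leEnat; apply: hm.
by case: excluded_middle_informative.
Qed.

Theorem corollary3p6 (K : finFieldType) (s : nat)
  (X : {set {ffun 'I_s -> K}}) (d : nat) (hd : (1 <= d)%N)
  (le : rel 'X_{1..s}) (hle : graded_monomial_order le)
  (r : nat) (hr1 : (1 <= r)%N)
  (hr2 : (r <= affine_hilbert (vanishing_ideal X) d)%N) :
  exists (delta : nat) (M : rat),
    [/\ is_gen_hamming_weight (RM_code X d) r delta,
        is_max (fun e : rat => exists2 F : r.-tuple {mpoly K[s]},
                  family_F le (vanishing_ideal X) d F
                  & e = degree (ideal_add (vanishing_ideal X) F)) M
      & delta%:R = degree (vanishing_ideal X) - M].
Proof.
(* Keeps the truncated subtraction in [card_code_supp_span] exact when it is compared or cast to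
   [rat]. *)
have leX (F : seq {mpoly K[s]}) : (#|zero_locus X F| <= #|X|)%N.
  by apply/subset_leq_card/subsetP => P; rewrite inE => /andP [].
have degE (F : seq {mpoly K[s]}) :
    degree (ideal_add (vanishing_ideal X) F) = #|zero_locus X F|%:R.
  by rewrite ideal_add_vanishing degree_vanishing.
have [|delta hdelta] := @ex_is_min_nat (fun w : nat =>
    exists D : {vspace 'rV[K]_#|X|},
    [/\ forall a, a \in D -> RM_code X d a, \dim D = r & w = #|code_supp D|]).
  move: hr2; rewrite affine_hilbert_vanishing => hr.
  (* The first [r] vectors of a basis span a subcode of dimension [r], so the minimum is over a
     nonempty set. *)
  pose B := take r (vbasis (code_space X d)).
  have fB : free B.
    have := basis_free (vbasisP (code_space X d)).
    by rewrite -{1}(cat_take_drop r (vbasis _)) => /catl_free.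
  exists #|code_supp <<B>>%VS|, <<B>>%VS; split=> // [a|].
    move=> aB; apply/code_spaceP; move: a aB; apply/subvP/span_subvP => u /mem_take.
    exact: vbasis_mem.
  by rewrite (eqP fB) size_take size_tuple; case: ltngtP hr.
have [[D [DC dimD deltaE]] dmin] := hdelta.
have hD : (D <= code_space X d)%VS by apply/subvP => a /DC /code_spaceP.
(* A subcode of minimal support yields the family that attains the maximum. *)
case: (standard_monic_basis hle hD); rewrite dimD => F [hF spanF].
exists delta, #|zero_locus X F|%:R; split=> //.
  split; first by exists F; rewrite ?degE.
  move=> _ [F' [hF1 hF2] ->]; rewrite degE Num.Theory.ler_nat.
  have fF' : free [seq ev X f | f <- F'].
    by apply: (free_standard hle) hF2 => f /hF1 [].
  (* Any competing family spans an [r]-dimensional subcode; minimality of [delta] then bounds its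
     zero locus. *)
  have := dmin #|code_supp <<[seq ev X f | f <- F']>>%VS|.
  rewrite Order.NatOrder.leEnat deltaE -{1}spanF !card_code_supp_span.
  rewrite leq_sub2lE //; apply.
  exists <<[seq ev X f | f <- F']>>%VS; split.
  - move=> a aD; apply/code_spaceP; move: a aD; apply/subvP/span_subvP.
    by move=> _ /mapP [f /hF1 [hf _ _] ->]; apply: code_space_ev.
  - by rewrite (eqP fF') size_map size_tuple.
  - by rewrite card_code_supp_span.
by rewrite degree_vanishing deltaE -spanF card_code_supp_span natrB.
Qed.
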